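(* Let $T\ge 1$, $u\ge 1$, $v\ge 0$ and $0\le\Delta\le T$ be integers and let $R=\frac{u+v}{2u+v}$. Consider the Embedded-Random Linear Code with parameters $(u,v,T,\Delta)$ over $\mathbb{F}_q$, whose coefficient matrices have entries drawn independently and uniformly at random from $\mathbb{F}_q$. Then, with probability tending to $1$ as $q\to\infty$ (with $u,v,T,\Delta$ fixed), the column span of the code is $$c_T=\begin{cases}\left\lfloor\frac{1-R}{R}\,\Delta\right\rfloor+1, & R\le \frac{\Delta}{T+1},\\[4pt] \left\lfloor(1-R)(T+1)\right\rfloor+1, & R>\frac{\Delta}{T+1}.\end{cases}$$
   Context: Embedded-Random Linear Code with parameters $(u,v,T,\Delta)$: each source packet at time $i\ge 0$ is $\mathbf{s}[i]=(\mathbf{u}[i],\mathbf{v}[i])$ with $\mathbf{u}[i]\in\mathbb{F}_q^u$ and $\mathbf{v}[i]\in\mathbb{F}_q^v$ (row vectors; all symbols at negative times are zero). Given matrices $\mathbf{G}_1,\dots,\mathbf{G}_{T-1}\in\mathbb{F}_q^{v\times u}$ and $\mathbf{H}_0,\dots,\mathbf{H}_{T-\Delta}\in\mathbb{F}_q^{u\times u}$, define the parity checks $$\mathbf{p}_v[i]=\sum_{j=1}^{T-1}\mathbf{v}[i-j]\,\mathbf{G}_j,\qquad \mathbf{p}_u[i]=\sum_{j=0}^{T-\Delta}\mathbf{u}[i-j]\,\mathbf{H}_j,$$ both in $\mathbb{F}_q^u$. The channel packet at time $i$ is $$\mathbf{x}[i]=\big(\mathbf{u}[i],\ \mathbf{v}[i],\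 \mathbf{p}_v[i]+\mathbf{p}_u[i-\Delta]\big)\in\mathbb{F}_q^{2u+v}.$$ The rate is $R=\frac{u+v}{2u+v}$. All entries of the $\mathbf{G}_j$ and $\mathbf{H}_j$ are independent and uniform on $\mathbb{F}_q$. Column span: for source packets $\mathbf{s}[0],\dots,\mathbf{s}[T]$ let $[\mathbf{x}[0],\dots,\mathbf{x}[T]]$ be the corresponding first $T+1$ channel packets, and let the span of this sequence be $j-i+1$, where $i$ and $j$ are the first and last time indices in $\{0,\dots,T\}$ at which the channel packet is nonzero. Then $c_T$ is the minimum of the span over all $\mathbf{s}[0],\dots,\mathbf{s}[T]$ with $\mathbf{s}[0]\ne 0$. *)

(* Defs.v *)
From mathcomp Require Import all_boot all_order all_algebra.

Set Implicit Arguments.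
Unset Strict Implicit.
Unset Printing Implicit Defensive.

Import Order.TTheory GRing.Theory Num.Theory.
Local Open Scope ring_scope.

Section EmbeddedRandomLinearCode.

Variables (F : finFieldType) (u v T Delta : nat).

(* (G, H) with G j standing for G_(j+1), 1 <= j+1 <= T-1, and H j for H_j,
   0 <= j <= T-Delta (the subtraction is truncated: Delta <= T is assumed). *)
Definition coeffs : predArgType :=
  ({ffun 'I_T.-1 -> 'M[F]_(v, u)} * {ffun 'I_(T - Delta).+1 -> 'M[F]_u})%type.

Definition sources : predArgType := {ffun 'I_T.+1 -> 'rV[F]_(u + v)}.

(* The source packet at an arbitrary integer time; it is zero at negative
   times. Times beyond T are never used: the code is causal. *)
Definition packet (s : sources) (i : int) : 'rV[F]_(u + v) :=
  if i is Posz n then oapp s 0 (insub n : option 'I_T.+1) else 0.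

Definition usym (s : sources) (i : int) : 'rV[F]_u := lsubmx (packet s i).
Definition vsym (s : sources) (i : int) : 'rV[F]_v := rsubmx (packet s i).

Definition parity_v (c : coeffs) (s : sources) (i : int) : 'rV[F]_u :=
  \sum_(j < T.-1) vsym s (i - (j.+1)%:Z) *m c.1 j.

Definition parity_u (c : coeffs) (s : sources) (i : int) : 'rV[F]_u :=
  \sum_(j < (T - Delta).+1) usym s (i - j%:Z) *m c.2 j.

Definition channel (c : coeffs) (s : sources) (i : int) : 'rV[F]_(u + v + u) :=
  row_mx (row_mx (usym s i) (vsym s i))
         (parity_v c s i + parity_u c s (i - Delta%:Z)).

(* x is meant to have a nonzero term; otherwise the value is a dummy. *)
Definition span_length (n : nat) (x : 'I_T.+1 -> 'rV[F]_n) : nat :=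
  let first := [arg min_(i < ord0 | x i != 0) (i : nat)] in
  let last := [arg max_(i > ord0 | x i != 0) (i : nat)] in
  (last - first).+1.

(* Spans never exceed T+1, so the default value T+1 does not affect the
   minimum, which ranges over a nonempty set as soon as 0 < u + v. *)
Definition column_span (c : coeffs) : nat :=
  \big[minn/T.+1]_(s : sources | s ord0 != 0)
     span_length (fun i : 'I_T.+1 => channel c s (i : nat)%:Z).

(* Drawing all the entries independently and uniformly from F amounts to
   drawing c uniformly from the finite set of all coefficient families. *)
Definition coeffs_prob (E : pred coeffs) : rat :=
  #|[set c | E c]|%:R / #|coeffs|%:R.

End EmbeddedRandomLinearCode.

Definition rate (u v : nat) : rat := (u + v)%:R / (2 * u + v)%:R.

Definition column_span_value (u v T Delta : nat) : int :=
  let R := rate u v in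
  if R <= Delta%:R / (T + 1)%:R
  then Num.floor ((1 - R) / R * Delta%:R) + 1
  else Num.floor ((1 - R) * (T + 1)%:R) + 1.

(* Main.v *)
(* Write w for the claimed column span minus one and q = #|F|.  For a fixed
   source sequence the parity symbols are linear in the coefficients, and the
   one at time i is [fresh] when some coefficient matrix multiplies a nonzero
   row there without influencing the earlier parities: the coefficient G_(i-t)
   of the first nonzero v[t], or H_(i-Delta-t) of the first nonzero u[t].  If n
   parities are fresh, they vanish with probability at most q^(-un).
   - No word of span at most w: a union bound over words up to scaling.  If
     (u+v) w <= u Delta, the parities before time Delta force v = 0 and then
     u[0] H_0 = 0 forces u[0] = 0.  Otherwise words with u and v both
     nonzero, with v = 0, and with u = 0 (where the parity at time T is not
     fresh) are counted separately.
   - Some word of span w+1: by dimension there are at least q^E solutions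
     supported on [0, w], where E = (2u+v)(w+1) - u(T+1) > 0, while the expected
     number of those with s[0] = 0 is O(q^(E-1)), so Markov's inequality
     applies. *)
Require Import Defs.
From mathcomp Require Import all_boot all_order all_algebra.
From mathcomp Require Import zify.

Set Implicit Arguments.
Unset Strict Implicit.
Unset Printing Implicit Defensive.

Import Order.TTheory GRing.Theory Num.Theory.
Local Open Scope ring_scope.

(** * Double counting and fibres of additive maps *)

Section Counting.

(** Double counting of the related pairs. This is Markov's inequality in counted form: [I] will be
    the coefficient families, [C] a set of words, and the right-hand side is [#|I|] times an
    expected number of solutions. *)
Lemma markov_card (I J : finType) (r : I -> J -> bool) (B : {set I})
    (C : {set J}) (K : nat) :
  (forall i, i \in B -> (K <= #|[set j in C | r i j]|)%N) ->
  (#|B| * K <= \sum_(j in C) #|[set i | r i j]|)%N.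
Proof.
move=> hB; rewrite -sum_nat_const.
apply: (@leq_trans (\sum_(i in B) \sum_(j in C) r i j)).
  apply: leq_sum => i /hB /leq_trans; apply.
  rewrite -sum1_card [leqLHS]big_mkcond [leqRHS]big_mkcond leq_sum // => j _.
  by rewrite inE; case: (j \in C); case: (r i j).
rewrite exchange_big leq_sum // => j _.
rewrite -sum1_card [leqRHS]big_mkcond [leqLHS]big_mkcond leq_sum // => i _.
by rewrite inE; case: (i \in B); case: (r i j).
Qed.

Lemma leq_sum_cover (I J : finType) (S : {set I}) (B : J -> {set I})
    (f : I -> nat) :
  S \subset \bigcup_j B j ->
  (\sum_(i in S) f i <= \sum_j \sum_(i in B j) f i)%N.
Proof.
move=> /subsetP SB; under [leqRHS]eq_bigr do rewrite big_mkcond.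
rewrite exchange_big [leqLHS]big_mkcond leq_sum //= => i _.
case: ifP => // /SB /bigcupP[j _ ij].
by rewrite (bigD1 j) //= ij leq_addr.
Qed.

(** A nonempty fibre of [f] on [S], translated by one of its members, embeds into the zero fibre,
    and there are at most [#|W|] fibres. The subtraction of [V] is an argument, so that [V] need
    only be a finite type. *)
Lemma card_zero_fiber (V : finType) (W : finZmodType) (sub : V -> V -> V)
    (f : V -> W) (S : {set V}) :
    (forall y, injective (sub^~ y)) -> {morph f : x y / sub x y >-> x - y} ->
    {in S &, forall x y, sub x y \in S} ->
  (#|S| <= #|[set x in S | f x == 0%R]| * #|W|)%N.
Proof.
move=> subI fB SB; have -> : #|S| = \sum_(w : W) #|[set x in S | f x == w]|.
  rewrite -sum1_card (partition_big f predT) //=.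
  apply: eq_bigr => w _; rewrite -sum1_card.
  by apply: eq_bigl => x; rewrite inE.
rewrite mulnC -sum_nat_const leq_sum // => w _.
have [->|[x]] := set_0Vmem [set x in S | f x == w]; first by rewrite cards0.
rewrite inE => /andP[xS /eqP fx].
rewrite -(card_imset [set x in S | f x == w] (subI x)) subset_leq_card //.
apply/subsetP => _ /imsetP[y /[!inE] /andP[yS /eqP fy] ->].
by rewrite SB //= fB fx fy subrr.
Qed.

End Counting.

(** * The encoder: linearity in the words and in the coefficients *)

Section Code.

Variables (F : finFieldType) (u v T Delta : nat).
Hypothesis leDT : (Delta <= T)%N.

Local Notation coeffs := (coeffs F u v T Delta).
Local Notation sources := (sources F u v T).
Local Notation q := #|F|.
Implicit Types (c d : coeffs) (s : sources) (i j k l m n t : nat).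

Definition usrc s n : 'rV[F]_u := usym s n%:Z.
Definition vsrc s n : 'rV[F]_v := vsym s n%:Z.
Definition parity c s n : 'rV[F]_u :=
  parity_v c s n%:Z + parity_u c s (n%:Z - Delta%:Z).

(** The window starts at [k] and has length [n], as in [iota]: its times are those of [k, k + n). *)
Definition zero_on c s k n := all (fun i => parity c s i == 0) (iota k n).

Lemma zero_onP c s k n :
  reflect (forall i, (k <= i < k + n)%N -> parity c s i = 0) (zero_on c s k n).
Proof.
apply: (iffP allP) => [h i ki|h i]; first by apply/eqP/h; rewrite mem_iota.
by rewrite mem_iota => /h ->.
Qed.

Lemma packet_linear (a : F) s s' (i : int) :
  packet (a *: s + s') i = a *: packet s i + packet s' i.
Proof.
case: i => n /=; last by rewrite scaler0 addr0.
by case: insub => [i|] /=; rewrite ?ffunE ?scaler0 ?addr0.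
Qed.

Lemma usym_linear (a : F) s s' (i : int) :
  usym (a *: s + s') i = a *: usym s i + usym s' i.
Proof. by rewrite /usym packet_linear linearP. Qed.

Lemma vsym_linear (a : F) s s' (i : int) :
  vsym (a *: s + s') i = a *: vsym s i + vsym s' i.
Proof. by rewrite /vsym packet_linear linearP. Qed.

Lemma parity_linear c (a : F) s s' n :
  parity c (a *: s + s') n = a *: parity c s n + parity c s' n.
Proof.
rewrite /parity scalerDr addrACA; congr (_ + _).
  rewrite scaler_sumr -big_split; apply: eq_bigr => j _.
  by rewrite vsym_linear mulmxDl scalemxAl.
rewrite scaler_sumr -big_split; apply: eq_bigr => j _.
by rewrite usym_linear mulmxDl scalemxAl.
Qed.

Lemma parityB c s s' n : parity c (s - s') n = parity c s n - parity c s' n.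
Proof. by rewrite -scaleN1r addrC parity_linear scaleN1r addrC. Qed.

Lemma parityZ c (a : F) s n : parity c (a *: s) n = a *: parity c s n.
Proof.
by rewrite -[a *: s]addr0 parity_linear -[in parity c 0 n](subrr 0)
  parityB subrr addr0.
Qed.

Lemma usrcB s s' n : usrc (s - s') n = usrc s n - usrc s' n.
Proof. by rewrite /usrc -scaleN1r addrC usym_linear scaleN1r addrC. Qed.

Lemma vsrcB s s' n : vsrc (s - s') n = vsrc s n - vsrc s' n.
Proof. by rewrite /vsrc -scaleN1r addrC vsym_linear scaleN1r addrC. Qed.

Lemma usrc0 n : usrc 0 n = 0.
Proof. by rewrite -(subrr 0) usrcB subrr. Qed.

Lemma vsrc0 n : vsrc 0 n = 0.
Proof. by rewrite -(subrr 0) vsrcB subrr. Qed.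

Lemma usrcZ (a : F) s n : usrc (a *: s) n = a *: usrc s n.
Proof. by rewrite -[a *: s]addr0 /usrc usym_linear [usym 0 _]usrc0 addr0. Qed.

Lemma vsrcZ (a : F) s n : vsrc (a *: s) n = a *: vsrc s n.
Proof. by rewrite -[a *: s]addr0 /vsrc vsym_linear [vsym 0 _]vsrc0 addr0. Qed.

Lemma parityD c d s n : parity (c + d) s n = parity c s n + parity d s n.
Proof.
rewrite /parity addrACA; congr (_ + _); rewrite -big_split;
  by apply: eq_bigr => j _; rewrite /= ffunE mulmxDr.
Qed.

Lemma usymB s n k :
  usym s (n%:Z - k%:Z) = if (k <= n)%N then usrc s (n - k) else 0.
Proof.
case: leqP => [kn|nk]; first by rewrite subzn.
have -> : n%:Z - k%:Z = Negz (k - n).-1 by lia.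
by rewrite /usym linear0.
Qed.

Lemma vsymB s n k :
  vsym s (n%:Z - k%:Z) = if (k <= n)%N then vsrc s (n - k) else 0.
Proof.
case: leqP => [kn|nk]; first by rewrite subzn.
have -> : n%:Z - k%:Z = Negz (k - n).-1 by lia.
by rewrite /vsym linear0.
Qed.

(** The guards stand for the zero symbols at negative times, so that reasoning about times can stay
    within natural numbers. *)
Lemma parityE c s n : parity c s n =
  \sum_(j < T.-1) (if (j < n)%N then vsrc s (n - j.+1) else 0) *m c.1 j +
  \sum_(j < (T - Delta).+1)
     (if (Delta + j <= n)%N then usrc s (n - (Delta + j)) else 0) *m c.2 j.
Proof.
rewrite /parity; congr (_ + _); apply: eq_bigr => j _; first by rewrite vsymB.
by rewrite -addrA -opprD -PoszD usymB.
Qed.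

Lemma usrc_out s n : (T < n)%N -> usrc s n = 0.
Proof.
by move=> Tn; rewrite /usrc /usym /= insubN ?linear0 // ltnS -ltnNge.
Qed.

Lemma vsrc_out s n : (T < n)%N -> vsrc s n = 0.
Proof.
by move=> Tn; rewrite /vsrc /vsym /= insubN ?linear0 // ltnS -ltnNge.
Qed.

Lemma srcE s (i : 'I_T.+1) : s i = row_mx (usrc s i) (vsrc s i).
Proof. by rewrite /usrc /vsrc /usym /vsym /= valK hsubmxK. Qed.

Lemma src_inj s s' :
  (forall n, usrc s n = usrc s' n) -> (forall n, vsrc s n = vsrc s' n) ->
  s = s'.
Proof. by move=> eu ev; apply/ffunP => i; rewrite !srcE eu ev. Qed.

(** * Fresh parities and the probability that they vanish *)

Lemma row_mx_solve (m : nat) (x : 'rV[F]_m) :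
  x != 0 -> exists M : 'rV[F]_u -> 'M[F]_(m, u), forall y, x *m M y = y.
Proof.
move=> x0; have /row_freeP[B xB] : row_free x by rewrite /row_free rank_rV x0.
by exists (mulmx B) => y; rewrite mulmxA xB mul1mx.
Qed.

(** Adding [d y] to the coefficients shifts the parity at time [n] by an arbitrary [y] and keeps all
    earlier ones. This plays the role of conditional uniformity given the earlier parities. *)
Definition fresh s n := exists d : 'rV[F]_u -> coeffs, forall y,
  parity (d y) s n = y /\ forall j, (j < n)%N -> parity (d y) s j = 0.

(** At time [n] the matrix G_(n-t) multiplies v[t]; at earlier times it multiplies a symbol
    preceding v[t], which is zero. The bound [n < t + T] keeps the index n - t at most T - 1. *)
Lemma fresh_v s t n : (forall j, (j < t)%N -> vsrc s j = 0) -> vsrc s t != 0 ->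
  (t < n < t + T)%N -> fresh s n.
Proof.
move=> v0 /row_mx_solve[M xM] /andP[tn nt].
(* The family [c.1] is numbered from 0 and G from 1, hence the predecessor. *)
have hj0 : ((n - t).-1 < T.-1)%N by lia.
pose j0 := Ordinal hj0.
have key y k : (k <= n)%N ->
    parity ([ffun j => if j == j0 then M y else 0], 0) s k =
    (if ((n - t).-1 < k)%N then vsrc s (k - (n - t).-1.+1) else 0) *m M y.
  move=> kn; rewrite parityE [X in _ + X]big1 ?addr0; last first.
    by move=> j _; rewrite ffunE mulmx0.
  rewrite (bigD1 j0) //= ffunE eqxx big1 ?addr0 // => j /negPf jj.
  by rewrite ffunE jj mulmx0.
exists (fun y => ([ffun j => if j == j0 then M y else 0], 0)) => y.
split=> [|k kn]; rewrite key ?(ltnW kn) //.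
  have -> : ((n - t).-1 < n)%N by lia.
  by have -> : (n - (n - t).-1.+1)%N = t by lia.
by case: ifP => h; rewrite ?mul0mx // v0 ?mul0mx //; lia.
Qed.

(** The same argument with H_(n-Delta-t), which multiplies u[t] at time [n]; [n <= T] keeps its
    index at most T - Delta. *)
Lemma fresh_u s t n : (forall j, (j < t)%N -> usrc s j = 0) -> usrc s t != 0 ->
  (Delta + t <= n <= T)%N -> fresh s n.
Proof.
move=> u0 /row_mx_solve[M xM] /andP[tn nT].
have hj0 : (n - (Delta + t) < (T - Delta).+1)%N by lia.
pose j0 := Ordinal hj0.
have key y k : (k <= n)%N ->
    parity (0, [ffun j => if j == j0 then M y else 0]) s k =
    (if (Delta + (n - (Delta + t)) <= k)%N
     then usrc s (k - (Delta + (n - (Delta + t)))) else 0) *m M y.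
  move=> kn; rewrite parityE [X in X + _]big1 ?add0r; last first.
    by move=> j _; rewrite ffunE mulmx0.
  rewrite (bigD1 j0) //= ffunE eqxx big1 ?addr0 // => j /negPf jj.
  by rewrite ffunE jj mulmx0.
exists (fun y => (0, [ffun j => if j == j0 then M y else 0])) => y.
split=> [|k kn]; rewrite key ?(ltnW kn) //.
  have -> : (Delta + (n - (Delta + t)) <= n)%N by lia.
  by have -> : (n - (Delta + (n - (Delta + t))))%N = t by lia.
by case: ifP => h; rewrite ?mul0mx // u0 ?mul0mx //; lia.
Qed.

Lemma zero_onS c s k n :
  zero_on c s k n.+1 = zero_on c s k n && (parity c s (k + n) == 0).
Proof. by rewrite /zero_on -[n.+1]addn1 iotaD all_cat /= andbT. Qed.

(** Each fresh parity divides the count by q^u. The map sending (c, y) to c + d y lands in the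
    families that vanish on the window shortened by its last time, and it is injective: the parity
    at that last time returns y, and then c. *)
Lemma card_zero_on s k n :
  (forall i, (k <= i < k + n)%N -> fresh s i) ->
  (#|[set c | zero_on c s k n]| * q ^ (u * n) <= #|coeffs|)%N.
Proof.
elim: n => [|n IH] fr; first by rewrite muln0 muln1 max_card.
apply: leq_trans (IH _); last by move=> i hi; apply: fr; lia.
rewrite mulnS expnD mulnA leq_mul2r; apply/orP; right.
have [d dP] := fr (k + n)%N ltac:(lia).
have -> : (q ^ u = #|[set: 'rV[F]_u]|)%N by rewrite cardsT card_mx mul1n.
rewrite -cardsX; pose f (p : coeffs * 'rV[F]_u) := p.1 + d p.2.
rewrite -(@card_in_imset _ _ f) => [|[c y] [c' y']].
  apply/subset_leq_card/subsetP => _ /imsetP[[c y] + ->].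
  rewrite !inE /= andbT zero_onS => /andP[/zero_onP cz _].
  by apply/zero_onP => i hi; rewrite parityD cz // add0r (dP y).2 //; lia.
rewrite !inE /= !andbT !zero_onS => /andP[_ /eqP cz] /andP[_ /eqP cz'].
rewrite /f /= => e.
have ey : y = y'.
  by rewrite -(dP y).1 -(dP y').1 -[LHS]add0r -[RHS]add0r -[in LHS]cz -cz'
    -!parityD e.
by move: e; rewrite ey => /addIr ->.
Qed.

(** * Words of bounded support *)

(** The u-symbols live in [a, k) and the v-symbols in [b, k); taking [a = k] or [b = k] forbids that
    kind of symbol. *)
Definition supported a b k : {set sources} :=
  [set s | [forall i : 'I_T.+1, (~~ (a <= i < k)%N ==> (usrc s i == 0)) &&
                                (~~ (b <= i < k)%N ==> (vsrc s i == 0))]].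

Lemma supportedP a b k s :
  reflect ((forall n, ~~ (a <= n < k)%N -> usrc s n = 0) /\
           (forall n, ~~ (b <= n < k)%N -> vsrc s n = 0))
          (s \in supported a b k).
Proof.
rewrite inE; apply: (iffP forallP) => [h|[hu hv] i]; last first.
  by apply/andP; split; apply/implyP => hi; rewrite ?hu ?hv.
split=> n hn;
  (have [nT|Tn] := leqP n T; last by rewrite ?usrc_out ?vsrc_out).
  by have /andP[/implyP/(_ hn)/eqP] := h (Ordinal (nT : (n < T.+1)%N)).
by have /andP[_ /implyP/(_ hn)/eqP] := h (Ordinal (nT : (n < T.+1)%N)).
Qed.

Lemma card_supported a b k :
  (#|supported a b k| <= q ^ (u * (k - a) + v * (k - b)))%N.
Proof.
pose f s : {ffun 'I_(k - a) -> 'rV[F]_u} * {ffun 'I_(k - b) -> 'rV[F]_v} :=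
  ([ffun i : 'I__ => usrc s (a + i)], [ffun i : 'I__ => vsrc s (b + i)]).
have fI : {in supported a b k &, injective f}.
  move=> s s' /supportedP[su sv] /supportedP[su' sv'] [/ffunP eu /ffunP ev].
  apply: src_inj => n.
    have [/andP[an nk]|h] := boolP (a <= n < k)%N; last by rewrite su // su'.
    by have := eu (Ordinal (ltn_sub2r (leq_ltn_trans an nk) nk));
      rewrite !ffunE /= subnKC.
  have [/andP[an nk]|h] := boolP (b <= n < k)%N; last by rewrite sv // sv'.
  by have := ev (Ordinal (ltn_sub2r (leq_ltn_trans an nk) nk));
      rewrite !ffunE /= subnKC.
rewrite -(card_in_imset fI) (leq_trans (max_card _)) //.
by rewrite card_prod !card_ffun !card_mx !card_ord !mul1n -!expnM expnD.
Qed.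

Definition mksrc (f : nat -> 'rV[F]_u) (g : nat -> 'rV[F]_v) : sources :=
  [ffun i : 'I_T.+1 => row_mx (f i) (g i)].

Lemma usrc_mk f g n : usrc (mksrc f g) n = if (n <= T)%N then f n else 0.
Proof.
case: leqP => nT; last by rewrite usrc_out.
have := srcE (mksrc f g) (Ordinal (nT : (n < T.+1)%N)).
by rewrite ffunE => /eq_row_mx[].
Qed.

Lemma vsrc_mk f g n : vsrc (mksrc f g) n = if (n <= T)%N then g n else 0.
Proof.
case: leqP => nT; last by rewrite vsrc_out.
have := srcE (mksrc f g) (Ordinal (nT : (n < T.+1)%N)).
by rewrite ffunE => /eq_row_mx[].
Qed.

Lemma card_supported_ge k :
  (k <= T.+1)%N -> (q ^ ((u + v) * k) <= #|supported 0 0 k|)%N.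
Proof.
move=> kT; pose f (p : {ffun 'I_k -> 'rV[F]_u} * {ffun 'I_k -> 'rV[F]_v}) :=
  mksrc (fun n => oapp p.1 0 (insub n)) (fun n => oapp p.2 0 (insub n)).
have fI : injective f.
  move=> [x y] [x' y'] e; congr (_, _); apply/ffunP => i.
    have := congr1 (fun s => usrc s i) e; rewrite !usrc_mk /= !valK /=.
    by rewrite -ltnS (leq_trans (ltn_ord i) kT).
  have := congr1 (fun s => vsrc s i) e; rewrite !vsrc_mk /= !valK /=.
  by rewrite -ltnS (leq_trans (ltn_ord i) kT).
have -> : (q ^ ((u + v) * k) = #|[set f p | p in {: _ * _}]|)%N.
  by rewrite card_imset // card_prod !card_ffun !card_mx !card_ord !mul1n
    -!expnM -expnD mulnDl.
apply/subset_leq_card/subsetP => _ /imsetP[p _ ->]; apply/supportedP.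
by split=> n nk; rewrite ?usrc_mk ?vsrc_mk insubN ?if_same.
Qed.

(** Causality: the parity at time [n] sees u only up to time n - Delta, and v only up to time n -
    1. *)
Lemma parity_ext c s s' n :
  (forall j, (Delta + j <= n)%N -> usrc s j = usrc s' j) ->
  (forall j, (j < n)%N -> vsrc s j = vsrc s' j) -> parity c s n = parity c s' n.
Proof.
move=> eu ev; rewrite !parityE; congr (_ + _); apply: eq_bigr => j _;
  case: ifP => // h; congr (_ *m _); [apply: ev | apply: eu]; lia.
Qed.

Definition unonzero s := [exists i : 'I_T.+1, usrc s i != 0].
Definition vnonzero s := [exists i : 'I_T.+1, vsrc s i != 0].

Lemma first_nonzero (m : nat) (f : nat -> 'rV[F]_m) n : f n != 0 ->
  exists t, [/\ (t <= n)%N, f t != 0 & forall j, (j < t)%N -> f j = 0].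
Proof.
move=> fn; have [t ft tmin] := ex_minnP (ex_intro (fun n => f n != 0) n fn).
exists t; split=> // [|j jt]; first exact: tmin.
by apply: contraTeq jt; rewrite -leqNgt => /tmin.
Qed.

Lemma unonzeroP s : unonzero s ->
  exists t,
  [/\ (t <= T)%N, usrc s t != 0 & forall j, (j < t)%N -> usrc s j = 0].
Proof.
move=> /existsP[i /first_nonzero[t [ti ft fj]]]; exists t; split=> //.
by rewrite (leq_trans ti) // -ltnS.
Qed.

Lemma vnonzeroP s : vnonzero s ->
  exists t,
  [/\ (t <= T)%N, vsrc s t != 0 & forall j, (j < t)%N -> vsrc s j = 0].
Proof.
move=> /existsP[i /first_nonzero[t [ti ft fj]]]; exists t; split=> //.
by rewrite (leq_trans ti) // -ltnS.
Qed.

Lemma unonzeroN s : ~~ unonzero s -> forall n, usrc s n = 0.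
Proof.
move=> /existsPn h n; have [nT|Tn] := leqP n T; last by rewrite usrc_out.
by have /negPn/eqP := h (Ordinal (nT : (n < T.+1)%N)).
Qed.

Lemma vnonzeroN s : ~~ vnonzero s -> forall n, vsrc s n = 0.
Proof.
move=> /existsPn h n; have [nT|Tn] := leqP n T; last by rewrite vsrc_out.
by have /negPn/eqP := h (Ordinal (nT : (n < T.+1)%N)).
Qed.

Lemma unonzeroZ (a : F) s : a != 0 -> unonzero (a *: s) = unonzero s.
Proof.
move=> /negPf a0; apply: eq_existsb => i.
by rewrite usrcZ scaler_eq0 a0.
Qed.

Lemma vnonzeroZ (a : F) s : a != 0 -> vnonzero (a *: s) = vnonzero s.
Proof.
move=> /negPf a0; apply: eq_existsb => i.
by rewrite vsrcZ scaler_eq0 a0.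
Qed.

Lemma supportedZ a b k (x : F) s :
  s \in supported a b k -> x *: s \in supported a b k.
Proof.
move=> /supportedP[su sv]; apply/supportedP.
by split=> n hn; rewrite ?usrcZ ?vsrcZ ?su ?sv ?scaler0.
Qed.

(** * First-moment bounds over classes of words *)

Lemma sum_card_zero_on (C : {set sources}) k n x :
  (#|C| <= q ^ x)%N ->
  (forall s i, s \in C -> (k <= i < k + n)%N -> fresh s i) ->
  ((\sum_(s in C) #|[set c | zero_on c s k n]|) * q ^ (u * n)
     <= q ^ x * #|coeffs|)%N.
Proof.
move=> hC fr; rewrite big_distrl /=.
apply: (@leq_trans (\sum_(s in C) #|coeffs|)).
  by apply: leq_sum => s sC; apply: card_zero_on => i; apply: fr.
by rewrite sum_nat_const leq_mul2r hC orbT.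
Qed.

Definition killed (C : {set sources}) k n : {set coeffs} :=
  [set c | [exists s in C, zero_on c s k n]].

(* A nonzero word in the kernel comes with its q - 1 nonzero multiples. *)
Lemma card_killed (C : {set sources}) k n x :
  0 \notin C -> (forall (a : F) s, a != 0 -> s \in C -> a *: s \in C) ->
  (#|C| <= q ^ x)%N -> (x <= u * n)%N ->
  (forall s i, s \in C -> (k <= i < k + n)%N -> fresh s i) ->
  (#|killed C k n| * q.-1 <= #|coeffs|)%N.
Proof.
move=> C0 CZ hC xn fr; have q0 : (0 < q)%N by apply/card_gt0P; exists 0.
have := sum_card_zero_on hC fr.
have : (q ^ x <= q ^ (u * n))%N by rewrite leq_pexp2l.
move=> /(leq_mul (leqnn #|coeffs|)) h1 h2.
have {h1 h2} := leq_trans h2 (leq_trans (eq_leq (mulnC _ _)) h1).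
rewrite leq_pmul2r ?expn_gt0 ?q0 //; apply: leq_trans.
apply: (markov_card (r := fun c s => zero_on c s k n)) => c.
rewrite inE => /existsP[s /andP[sC /zero_onP cs]].
have s0 : s != 0 by apply: contraNneq C0 => <-.
rewrite -(cardC1 (0 : F)) -(card_imset _ (f := fun a => a *: s)); last first.
  move=> a b /eqP; rewrite -subr_eq0 -scalerBl scaler_eq0 (negPf s0) orbF.
  by rewrite subr_eq0 => /eqP.
apply/subset_leq_card/subsetP => _ /imsetP[a a0 ->]; rewrite inE CZ //=.
by apply/zero_onP => i hi; rewrite parityZ cs // scaler0.
Qed.

(** The parities before time [w] are left free: the packets there may be anything, and those from
    [w] to T must vanish. *)
Definition early w : {set coeffs} :=
  [set c | [exists s : sources, [&& s ord0 != 0, s \in supported 0 0 w &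
                          zero_on c s w (T.+1 - w)]]].

Lemma earlyP c w :
  reflect (exists s : sources, [/\ s ord0 != 0, s \in supported 0 0 w &
                         zero_on c s w (T.+1 - w)]) (c \in early w).
Proof. by rewrite inE; apply: (iffP existsP) => -[s /and3P h]; exists s. Qed.

Lemma mem_killed (C : {set sources}) k n c s :
  s \in C -> zero_on c s k n -> c \in killed C k n.
Proof. by move=> sC cs; rewrite inE; apply/existsP; exists s; rewrite sC. Qed.

Lemma card_supported_sub a b k (P : pred sources) :
  (#|[set s in supported a b k | P s]| <= q ^ (u * (k - a) + v * (k - b)))%N.
Proof.
apply: leq_trans (card_supported a b k); apply/subset_leq_card/subsetP => s.
by rewrite inE => /andP[].
Qed.

Lemma supported_u_range a b k s t : s \in supported a b k -> usrc s t != 0 ->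
  (a <= t < k)%N.
Proof. by case/supportedP => su _; apply: contraNT => /su ->. Qed.

Lemma supported_v_range a b k s t : s \in supported a b k -> vsrc s t != 0 ->
  (b <= t < k)%N.
Proof. by case/supportedP => _ sv; apply: contraNT => /sv ->. Qed.

(** * No word of span at most w *)

(** The classes of the union bound: a single symbol u[0]; v-symbols only; u-symbols only, starting
    at time 0; both kinds present. *)
Definition u0_word := [set s in supported 0 1 1 | usrc s 0 != 0].
Definition v_words w := [set s in supported w 0 w | vnonzero s].
Definition u_words w := [set s in supported 0 w w | usrc s 0 != 0].
Definition uv_words w := [set s in supported 0 0 w | unonzero s && vnonzero s].

Lemma card_killed_u0_word : (#|killed u0_word Delta 1| * q.-1 <= #|coeffs|)%N.
Proof.
apply: card_killed (card_supported_sub _ _ _ _) _ _ => [|a s a0||s i].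
- by rewrite inE usrc0 eqxx andbF.
- by rewrite ![in _ \in u0_word]inE usrcZ scaler_eq0 (negPf a0) => /andP[/supportedZ ->].
- by rewrite subnn subn0 !muln1 muln0 addn0.
- rewrite inE => /andP[sS u0] hi; apply: (@fresh_u s 0) => //; lia.
Qed.

Lemma card_killed_u_words w k n :
  (Delta < w)%N -> (w <= k)%N -> (k + n <= T.+1)%N ->
  (w <= n)%N -> (#|killed (u_words w) k n| * q.-1 <= #|coeffs|)%N.
Proof.
move=> Dw wk knT wn.
apply: card_killed (card_supported_sub _ _ _ _) _ _ => [|a s a0||s i].
- by rewrite inE usrc0 eqxx andbF.
- by rewrite ![in _ \in u_words _]inE usrcZ scaler_eq0 (negPf a0) => /andP[/supportedZ ->].
- by rewrite subnn muln0 addn0 leq_mul2l subn0 wn orbT.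
- rewrite inE => /andP[sS u0] hi; apply: (@fresh_u s 0) => //; lia.
Qed.

(** The window ends before T because the parity at time T does not see v[0], so it need not be
    fresh. *)
Lemma card_killed_v_words w k n : (w <= k)%N -> (k + n <= T)%N ->
  (v * w <= u * n)%N -> (#|killed (v_words w) k n| * q.-1 <= #|coeffs|)%N.
Proof.
move=> wk knT vw.
apply: card_killed (card_supported_sub _ _ _ _) _ _ => [|a s a0||s i].
- by rewrite inE negb_and; apply/orP; right; apply/existsPn => i; rewrite vsrc0 eqxx.
- by rewrite ![in _ \in v_words _]inE vnonzeroZ // => /andP[/supportedZ ->].
- by rewrite subnn muln0 add0n subn0.
- rewrite inE => /andP[sS /vnonzeroP[t [tT vt v0]]] hi.
  by have tw := supported_v_range sS vt; apply: (fresh_v v0 vt); lia.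
Qed.

(** Let t be the time of the first nonzero u-symbol. Parities from Delta + t on are fresh through u,
    the others through v. As Delta + t < Delta + w <= T, time T falls in the first range. *)
Lemma card_killed_uv_words w n : (w + n <= T.+1)%N -> (Delta + w <= T)%N ->
  ((u + v) * w <= u * n)%N ->
  (#|killed (uv_words w) w n| * q.-1 <= #|coeffs|)%N.
Proof.
move=> wnT DwT uvw.
apply: card_killed (card_supported_sub _ _ _ _) _ _ => [|a s a0||s i].
- by rewrite inE !negb_and; apply/orP; right; apply/orP; left; apply/existsPn => i;
    rewrite usrc0 eqxx.
- by rewrite ![in _ \in uv_words _]inE vnonzeroZ // unonzeroZ // => /andP[/supportedZ ->].
- by rewrite !subn0 -mulnDl.
- rewrite inE => /and3P[sS /unonzeroP[t [tT ut u0]] /vnonzeroP[t' [tT' vt v0]]] hi.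
  have tw := supported_v_range sS vt; have tw' := supported_u_range sS ut.
  have [Dti|iDt] := leqP (Delta + t) i; first by apply: (fresh_u u0 ut); lia.
  by apply: (fresh_v v0 vt); lia.
Qed.

(* With no [v]-symbols, the parity at time [Delta] is [u[0] H_0]. *)
Lemma killed_u0_word c s : usrc s 0 != 0 -> ~~ vnonzero s ->
  parity c s Delta = 0 ->
  c \in killed u0_word Delta 1.
Proof.
move=> u0 /vnonzeroN v0 cs.
pose s' := mksrc (fun n => if n == 0%N then usrc s 0 else 0) (fun=> 0).
apply: (@mem_killed _ _ _ _ s').
  rewrite inE usrc_mk /= u0 andbT; apply/supportedP.
  by split=> -[|n] hn; rewrite ?usrc_mk ?vsrc_mk //= ?if_same.
apply/zero_onP => i hi; have -> : i = Delta by lia.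
rewrite -cs; apply: parity_ext => j hj; last by rewrite v0 vsrc_mk if_same.
have j0 : j = 0%N by lia.
by rewrite j0 usrc_mk.
Qed.

Lemma src_neq0 s : (s ord0 != 0) = (usrc s 0 != 0) || (vsrc s 0 != 0).
Proof.
rewrite srcE -negb_and; congr (~~ _); apply/eqP/andP => [|[/eqP-> /eqP->]].
  by rewrite -row_mx0 => /eq_row_mx[-> ->].
by rewrite row_mx0.
Qed.

(** The hypothesis amounts to v w <= u (Delta - w), the count required for the v-symbols on the
    window [w, Delta). *)
Lemma card_early_small w : ((u + v) * w <= u * Delta)%N -> (0 < u)%N ->
  (#|early w| * q.-1 <= 2 * #|coeffs|)%N.
Proof.
move=> hw u0; have wD : (w <= Delta)%N by nia.
have sub : early w \subset
    killed u0_word Delta 1 :|: killed (v_words w) w (Delta - w).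
  apply/subsetP => c /earlyP[s [s0 /supportedP[su sv] /zero_onP cs]]; rewrite inE.
  have [vs|vs] := boolP (vnonzero s); apply/orP; [right|left].
    (* Parities before [Delta] do not see the u-symbols, so these can be erased. *)
    apply: (@mem_killed _ _ _ _ (mksrc (fun=> 0) (vsrc s))).
      rewrite inE; apply/andP; split.
        by apply/supportedP; split=> n hn; rewrite ?usrc_mk ?vsrc_mk ?sv ?if_same.
      have [t [tT vt _]] := vnonzeroP vs.
      by apply/existsP; exists (Ordinal (tT : (t < T.+1)%N)); rewrite vsrc_mk /= tT.
    apply/zero_onP => i hi; rewrite -(cs i); last lia.
    apply: parity_ext => j hj; first lia.
    rewrite vsrc_mk; case: leqP => // Tj; by rewrite vsrc_out.
  apply: (@killed_u0_word c s) => //; last by apply: cs; lia.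
  by move: s0; rewrite src_neq0 (vnonzeroN vs) eqxx orbF.
have le := leq_trans (subset_leq_card sub) (leq_card_setU _ _).1.
apply: leq_trans (leq_mul le (leqnn _)) _; rewrite mulnDl mul2n -addnn.
by rewrite leq_add ?card_killed_u0_word ?card_killed_v_words //; nia.
Qed.

Lemma card_early_large w : ((2 * u + v) * w <= u * T.+1)%N ->
  (Delta + w <= T)%N -> (0 < u)%N -> (#|early w| * q.-1 <= 3 * #|coeffs|)%N.
Proof.
move=> hw DwT u0.
(* Words without v-symbols: if w <= Delta the parity u[0] H_0 at time [Delta] suffices; otherwise
   every parity in [w, T] is fresh through u[0], and 2 w <= T + 1. *)
pose A := if (w <= Delta)%N then killed u0_word Delta 1
  else killed (u_words w) w (T.+1 - w).
have cA : (#|A| * q.-1 <= #|coeffs|)%N.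
  rewrite /A; case: (leqP w Delta) => wD; first exact: card_killed_u0_word.
  by apply: card_killed_u_words => //; nia.
have sub : early w \subset
    A :|: killed (v_words w) w (T - w) :|: killed (uv_words w) w (T.+1 - w).
  apply/subsetP => c /earlyP[s [s0 sS cs]]; have /supportedP[su sv] := sS.
  rewrite !in_setU; apply/orP.
  have [us|us] := boolP (unonzero s); last first.
    left; apply/orP; right; apply: (@mem_killed _ _ _ _ s); last first.
      by apply/zero_onP => i hi; move/zero_onP: cs; apply; lia.
    rewrite inE; apply/andP; split.
      by apply/supportedP; split=> n hn; rewrite ?(unonzeroN us) ?sv.
    apply: contraNT us => /vnonzeroN vs; apply/existsP; exists ord0.
    by move: s0; rewrite src_neq0 vs eqxx orbF.
  have [vs|vs] := boolP (vnonzero s).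
    by right; apply: (@mem_killed _ _ _ _ s); rewrite // inE sS us vs.
  have us0 : usrc s 0 != 0 by move: s0; rewrite src_neq0 (vnonzeroN vs) eqxx orbF.
  left; apply/orP; left; rewrite /A; case: (leqP w Delta) => wD.
    by apply: (killed_u0_word us0 vs); move/zero_onP: cs; apply; lia.
  apply: (@mem_killed _ _ _ _ s) => //; rewrite inE us0 andbT.
  by apply/supportedP; split=> n hn; rewrite ?(vnonzeroN vs) ?su.
have le := leq_trans (subset_leq_card sub) (leq_card_setU _ _).1.
have {}le := leq_trans le (leq_add (leq_card_setU _ _).1 (leqnn _)).
apply: leq_trans (leq_mul le (leqnn _)) _.
rewrite !mulnDl !mulSn mul0n addn0 addnA.
apply: leq_add; first (apply: leq_add => //; apply: card_killed_v_words => //; try lia).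
  (* Omitting time T costs u equations. For w > 0 this is covered by u w, the symbols that a word
     with u = 0 does not use. *)
  case: (posnP w) => [->|w0]; first by rewrite muln0.
  have : (u <= u * w)%N by rewrite leq_pmulr.
  by move: hw; rewrite mulnBr mulnS !mulnDl; lia.
by apply: card_killed_uv_words => //; rewrite ?subnKC //; move: hw; rewrite ?mulnBr; lia.
Qed.

(** * Existence of a word of span w+1 *)

(** A dimension count: each parity imposes u linear equations, so it shrinks the solution space by a
    factor at most q^u. *)
Lemma card_kernel_ge c m n : (m <= T.+1)%N ->
  (q ^ ((u + v) * m) <=
     #|[set s in supported 0 0 m | zero_on c s m n]| * q ^ (u * n))%N.
Proof.
move=> mT; elim: n => [|n IH].
  rewrite muln0 muln1 (leq_trans (card_supported_ge mT)) //.
  by apply/subset_leq_card/subsetP => s sS; rewrite inE sS.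
apply: leq_trans IH _; rewrite mulnS expnD mulnA leq_mul2r; apply/orP; right.
have := @card_zero_fiber sources 'rV[F]_u (fun s s' => s - s')
  (fun s => parity c s (m + n)) [set s in supported 0 0 m | zero_on c s m n].
rewrite card_mx mul1n => /(_ (fun s => addIr _)) h.
apply: leq_trans (h _ _) _ => [s s'|s s'|]; first exact: parityB.
  rewrite inE => /andP[/supportedP[su sv] /zero_onP z].
  rewrite inE => /andP[/supportedP[su' sv'] /zero_onP z'].
  rewrite inE; apply/andP; split.
    by apply/supportedP; split=> i hi; rewrite ?usrcB ?vsrcB ?su ?su' ?sv ?sv' ?subrr.
  by apply/zero_onP => i hi; rewrite parityB z // z' // subrr.
rewrite leq_mul2r; apply/orP; right.
apply/subset_leq_card/subsetP => s.
rewrite inE => /andP[+ sz]; rewrite inE => /andP[sS z].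
by rewrite inE sS zero_onS z.
Qed.

(** One class of the first-moment estimate: its expected number of solutions is at most q^(E-1).
    Only a subwindow of fresh parities is exploited. *)
Lemma sum_zero_class (C : {set sources}) m l k n x E :
  (#|C| <= q ^ x)%N ->
  (forall i, (k <= i < k + n)%N -> (m <= i < m + l)%N) ->
  (forall s i, s \in C -> (k <= i < k + n)%N -> fresh s i) ->
  (x < E + u * n)%N ->
  ((\sum_(s in C) #|[set c | zero_on c s m l]|) * q <= q ^ E * #|coeffs|)%N.
Proof.
move=> hC kn fr xE; have q0 : (0 < q)%N by apply/card_gt0P; exists 0.
apply: (@leq_trans ((\sum_(s in C) #|[set c | zero_on c s k n]|) * q)%N).
  rewrite leq_mul2r leq_sum ?orbT // => s _; apply/subset_leq_card/subsetP => c.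
  rewrite !inE => /zero_onP z; apply/zero_onP => i /kn; apply: z.
rewrite -(leq_pmul2r (m := q ^ (u * n))) ?expn_gt0 ?q0 // mulnAC.
apply: leq_trans (leq_mul (sum_card_zero_on hC fr) (leqnn q)) _.
by rewrite mulnAC -expnSr [leqRHS]mulnAC -expnD leq_mul2r leq_pexp2l ?orbT.
Qed.

(** Outside [early m] all of the at least q^E solutions have s[0] = 0. Such words fall into T + 2
    classes, each with at most q^(E-1) expected solutions. *)
Lemma card_not_early m : (0 < u)%N -> (m <= T.+1)%N ->
  (u * T.+1 < (2 * u + v) * m)%N -> (u * Delta < (u + v) * m)%N ->
  (#|~: early m| * q <= T.+2 * #|coeffs|)%N.
Proof.
move=> u0 mT hT hD; have q0 : (0 < q)%N by apply/card_gt0P; exists 0.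
have m0 : (0 < m)%N by nia.
pose E := ((u + v) * m - u * (T.+1 - m))%N.
have EE : ((u + v) * m = E + u * (T.+1 - m))%N by rewrite /E mulnBr; nia.
have E0 : (0 < E)%N by rewrite /E mulnBr; nia.
rewrite -(leq_pmul2r (m := q ^ E)) ?expn_gt0 ?q0 // mulnAC.
have mk : (#|~: early m| * q ^ E <=
    \sum_(s in supported 1 1 m) #|[set c | zero_on c s m (T.+1 - m)]|)%N.
  apply: (markov_card (r := fun c s => zero_on c s m (T.+1 - m))) => c.
  rewrite inE => cm; rewrite -(leq_pmul2r (m := q ^ (u * (T.+1 - m)))) ?expn_gt0 ?q0 //.
  rewrite -expnD -EE (leq_trans (card_kernel_ge c (T.+1 - m) mT)) // leq_mul2r.
  apply/orP; right; apply/subset_leq_card/subsetP => s.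
  rewrite inE => /andP[sS cs]; rewrite inE cs andbT.
  have : s ord0 == 0 by apply: contraNT cm => s0; apply/earlyP; exists s.
  rewrite -[_ == _]negbK src_neq0 negb_or !negbK => /andP[/eqP us /eqP vs].
  have /supportedP[su sv] := sS.
  by apply/supportedP; split=> -[|n] // hn; [apply: su | apply: sv].
(* The zero word, the words with some v-symbol, and the words without v-symbols whose first nonzero
   u-symbol is at time t + 1. *)
pose B (o : option (option 'I_T)) := match o with
  | None => [set (0 : sources)]
  | Some None => [set s in supported 1 1 m | vnonzero s]
  | Some (Some t) => [set s in supported t.+1 m m | usrc s t.+1 != 0]
  end.
have cover : supported 1 1 m \subset \bigcup_o B o.
  apply/subsetP => s sS; apply/bigcupP; have /supportedP[su sv] := sS.
  have [vs|vs] := boolP (vnonzero s); first by exists (Some None); rewrite // inE sS.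
  have [us|us] := boolP (unonzero s); last first.
    exists None => //; rewrite inE; apply/eqP/src_inj => n.
      by rewrite (unonzeroN us) usrc0.
    by rewrite (vnonzeroN vs) vsrc0.
  have [t [tT ut ut0]] := unonzeroP us.
  have t0 : (0 < t)%N by have := supported_u_range sS ut; lia.
  have t'T : (t.-1 < T)%N by lia.
  exists (Some (Some (Ordinal t'T))) => //=; rewrite inE /= (prednK t0) ut andbT.
  apply/supportedP; split=> n hn; last by rewrite (vnonzeroN vs).
  by have [/ut0 //|tn] := ltnP n t; apply: su; lia.
apply: leq_trans (leq_mul mk (leqnn _)) _.
apply: leq_trans (leq_mul (leq_sum_cover _ cover) (leqnn _)) _.
have -> : (T.+2 * #|coeffs| * q ^ E =
    \sum_(o : option (option 'I_T)) q ^ E * #|coeffs|)%N.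
  by rewrite sum_nat_const !card_option card_ord -mulnA (mulnC #|coeffs|).
rewrite big_distrl leq_sum //= => -[[t|]|] _ /=.
(* Freshness through u starts at time Delta + t + 1; the truncated length T + 1 - k is 0 if this
   lies beyond T. *)
- pose k := maxn m (Delta + t.+1).
  apply: (sum_zero_class (k := k) (n := T.+1 - k) (card_supported_sub _ _ _ _)).
  + by move=> i hi; lia.
  + move=> s i; rewrite inE => /andP[/supportedP[su _] ut] hi.
    by apply: (fresh_u _ ut) => [j jt|]; [apply: su | ]; lia.
  rewrite subnn muln0 addn0 /k; have [tm|mt] := ltnP t.+1 m; last first.
    by rewrite (eqP mt) muln0 addn_gt0 E0.
  have ut : (u <= u * t.+1)%N by rewrite leq_pmulr.
  rewrite /E; case: (leqP m (Delta + t.+1)) => [mD|Dm]; last first.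
    by rewrite -EE mulnBr; move: ut EE; rewrite mulnDl; lia.
  (* Since E = (2u+v) m - u (T+1), the first case is exactly u Delta < (u+v) m. The second asks for
     u (T - t) < (u+v) m, where T - t < Delta. *)
  have [DT|TD] := leqP (Delta + t.+1) T.+1.
    have := leq_mul (leqnn u) DT; have := leq_mul (leqnn u) mT.
    have := leq_mul (leqnn u) (ltnW tm).
    by move: hT hD ut; rewrite !mulnBr !mulnDr !mulnDl; lia.
  have -> : (T.+1 - (Delta + t.+1) = 0)%N by lia.
  have := leq_mul (leqnn u) (ltnW TD); have := leq_mul (leqnn u) mT.
  have := leq_mul (leqnn u) (ltnW tm).
  by move: hT hD ut; rewrite !mulnBr !mulnDr !mulnDl; lia.
(* The first nonzero v-symbol now comes at time 1 or later, so even the parity at time T is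
   fresh. *)
- apply: (sum_zero_class (k := m) (card_supported_sub _ _ _ _) (fun i hi => hi)).
    move=> s i; rewrite inE => /andP[sS /vnonzeroP[t [tT vt v0]]] hi.
    by have ht := supported_v_range sS vt; apply: (fresh_v v0 vt); lia.
  by rewrite -EE -mulnDl ltn_mul2l; lia.
- apply: (sum_zero_class (k := m) (n := 0) (x := 0)); rewrite ?cards1 ?muln0 ?addn0 //.
    by move=> i; lia.
  by move=> s i _; lia.
Qed.

(** * From [early] to the column span *)

(** As [x ord0] is nonzero, the first nonzero index is 0 and the span is the last nonzero index plus
    one. *)
Lemma span_length_leP (m : nat) (x : 'I_T.+1 -> 'rV[F]_m) k : x ord0 != 0 ->
  reflect (forall i : 'I_T.+1, (k < i)%N -> x i = 0) (span_length x <= k.+1)%N.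
Proof.
move=> x0; rewrite /span_length ltnS.
case: arg_minnP => // i _ /(_ _ x0); rewrite leqn0 => /eqP->.
rewrite subn0; case: arg_maxnP => // j xj jmax.
apply: (iffP idP) => [jk l kl|h].
  by apply: contraTeq kl => /jmax lj; rewrite -leqNgt (leq_trans lj).
by apply: contraR xj; rewrite -ltnNge => /h ->.
Qed.

Lemma channel_eq0 c s n :
  (channel c s n%:Z == 0) =
    [&& usrc s n == 0, vsrc s n == 0 & parity c s n == 0].
Proof.
rewrite /channel; apply/eqP/and3P => [|[/eqP un /eqP vn /eqP pn]].
  rewrite -row_mx0 => /eq_row_mx[]; rewrite -[X in _ = X -> _]row_mx0.
  by move=> /eq_row_mx[un vn] pn; split; apply/eqP.
by rewrite -[usym _ _]/(usrc s n) -[vsym _ _]/(vsrc s n)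
  -[_ + _]/(parity c s n) un vn pn !row_mx0.
Qed.

Lemma channel0 c s : s ord0 != 0 -> channel c s 0%:Z != 0.
Proof. by rewrite channel_eq0 src_neq0; do 2!case: eqP. Qed.

Lemma early_spanP c w : reflect
  (exists2 s : sources, s ord0 != 0 &
     (span_length (fun i : 'I_T.+1 => channel c s (i : nat)%:Z) <= w.+1)%N)
  (c \in early w.+1).
Proof.
apply: (iffP (earlyP _ _)) => [[s [s0 /supportedP[su sv] /zero_onP z]]|[s s0]].
  exists s => //; apply/span_length_leP => [|i wi]; first exact: channel0.
  apply/eqP; rewrite channel_eq0 su ?sv ?z ?eqxx //; have := ltn_ord i; lia.
move=> /(span_length_leP _ (channel0 c s0)) z; exists s.
have h (n : nat) : (w < n)%N -> (n <= T)%N ->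
    [&& usrc s n == 0, vsrc s n == 0 & parity c s n == 0].
  by move=> wn nT; rewrite -channel_eq0 (z (Ordinal (nT : (n < T.+1)%N))).
split=> //; last first.
  by apply/zero_onP => n hn; have /and3P[_ _ /eqP] : _ := h n ltac:(lia) ltac:(lia).
apply/supportedP; split=> n hn;
  (have [nT|Tn] := leqP n T; last by rewrite ?usrc_out ?vsrc_out).
  by have /and3P[/eqP] : _ := h n ltac:(lia) nT.
by have /and3P[_ /eqP] : _ := h n ltac:(lia) nT.
Qed.

Lemma column_span_eq c w : (w <= T)%N -> c \notin early w -> c \in early w.+1 ->
  column_span c = w.+1.
Proof.
move=> wT cw /early_spanP[s s0 sw]; apply/eqP; rewrite eqn_leq; apply/andP; split.
  by rewrite -leEnat /column_span -minEnat; apply: (bigmin_inf s).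
rewrite -leEnat /column_span -minEnat; apply/bigmin_geP; split=> // s' s'0.
(* For w = 0 the claim holds because a span is at least 1; [early_spanP] speaks of successors. *)
rewrite leEnat ltnNge; apply: contra cw; case: w {wT sw} => [|w] h.
  by [].
by apply/early_spanP; exists s'.
Qed.

Lemma card_column_span_neq w : (0 < u)%N -> (w <= T)%N ->
  ((u + v) * w <= u * Delta)%N ||
    (((2 * u + v) * w <= u * T.+1)%N && (Delta + w <= T)%N) ->
  (u * T.+1 < (2 * u + v) * w.+1)%N -> (u * Delta < (u + v) * w.+1)%N ->
  (#|[set c : coeffs | column_span c != w.+1]| * q.-1 <= (T + 5) * #|coeffs|)%N.
Proof.
move=> u0 wT hw hT hD.
have sub : [set c : coeffs | column_span c != w.+1]
    \subset early w :|: ~: early w.+1.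
  apply/subsetP => c; rewrite inE in_setU in_setC; apply: contraR.
  by rewrite negb_or negbK => /andP[c1 c2]; rewrite (column_span_eq wT c1 c2).
have le := leq_trans (subset_leq_card sub) (leq_card_setU _ _).1.
apply: leq_trans (leq_mul le (leqnn _)) _.
(* At most three classes of short words, and T + 2 classes for existence. *)
have -> : (T + 5 = 3 + T.+2)%N by lia.
rewrite !mulnDl; apply: leq_add.
  case/orP: hw => [hw|/andP[hw DwT]]; last exact: card_early_large.
  by apply: leq_trans (card_early_small hw u0) _; rewrite leq_mul2r orbT.
apply: leq_trans (card_not_early u0 (wT : (w.+1 <= T.+1)%N) hT hD).
by rewrite leq_mul2l leq_pred orbT.
Qed.

End Code.

(** * The closed formula and the limit *)

Lemma floor_natdiv (a b : nat) : (0 < b)%N ->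
  Num.floor (a%:R / b%:R : rat) = (a %/ b)%N%:Z.
Proof.
move=> b0; have b0' : 0 < b%:R :> rat by rewrite ltr0n.
apply: floor_def; rewrite -[(_ + 1)]/(((a %/ b) + 1)%N%:Z) -!pmulrn.
rewrite ler_pdivlMr // ltr_pdivrMr // -!natrM ler_nat ltr_nat.
by rewrite leq_divM addn1 ltn_ceil.
Qed.

(** The test is R <= Delta / (T+1) cleared of denominators, and the quotients come from (1-R)/R =
    u/(u+v) and 1-R = u/(2u+v). *)
Definition span_index (T u v Delta : nat) : nat :=
  if ((u + v) * T.+1 <= Delta * (2 * u + v))%N then ((u * Delta) %/ (u + v))%N
  else ((u * T.+1) %/ (2 * u + v))%N.

Lemma column_span_valueE (T u v Delta : nat) : (0 < u)%N ->
  column_span_value u v T Delta = (span_index T u v Delta).+1%:Z.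
Proof.
move=> u0; rewrite /column_span_value /rate /span_index addn1.
have [a0 b0] : (0 < (u + v)%:R :> rat /\ 0 < (2 * u + v)%:R :> rat).
  by rewrite !ltr0n; lia.
have T0 : 0 < T.+1%:R :> rat by rewrite ltr0n.
have e : 1 - (u + v)%:R / (2 * u + v)%:R = u%:R / (2 * u + v)%:R :> rat.
  apply: (canRL (mulfK (lt0r_neq0 b0))); rewrite mulrBl mulfVK ?lt0r_neq0 //.
  by rewrite mul1r -natrB; [congr _%:R|]; lia.
rewrite e ler_pdivrMr // mulrAC ler_pdivlMr // -!natrM ler_nat.
case: ifP => _; rewrite intS [RHS]addrC.
  have -> : u%:R / (2 * u + v)%:R / ((u + v)%:R / (2 * u + v)%:R) * Delta%:R
      = (u * Delta)%:R / (u + v)%:R :> rat.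
    by rewrite invf_div mulrA mulfVK ?lt0r_neq0 // mulrAC natrM.
  by rewrite floor_natdiv //; lia.
have -> : u%:R / (2 * u + v)%:R * T.+1%:R
    = (u * T.+1)%:R / (2 * u + v)%:R :> rat.
  by rewrite mulrAC natrM.
by rewrite floor_natdiv //; lia.
Qed.

(** The case distinction selects the larger of u Delta / (u+v) and u (T+1) / (2u+v). The index is
    the floor of this maximum, so its successor exceeds both. *)
Lemma span_index_bounds (T u v Delta : nat) (w := span_index T u v Delta) :
  (0 < u)%N -> (Delta <= T)%N ->
  [/\ (w <= T)%N,
      ((u + v) * w <= u * Delta)%N ||
        (((2 * u + v) * w <= u * T.+1)%N && (Delta + w <= T)%N),
      (u * T.+1 < (2 * u + v) * w.+1)%N & (u * Delta < (u + v) * w.+1)%N].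
Proof.
move=> u0 DT; rewrite /w /span_index.
case: (leqP ((u + v) * T.+1) (Delta * (2 * u + v))) => h.
  set k := (_ %/ _)%N.
  have k1 : (k * (u + v) <= u * Delta)%N by rewrite leq_divM.
  have k2 : (u * Delta < k.+1 * (u + v))%N by rewrite ltn_ceil //; lia.
  have k3 : (u * T.+1 < (2 * u + v) * k.+1)%N.
    rewrite -(ltn_pmul2r (m := u + v)); last lia.
    rewrite -(ltn_pmul2l (m := 2 * u + v)) in k2; last lia.
    rewrite -[ltnRHS]mulnA; apply: leq_ltn_trans k2; rewrite -[leqLHS]mulnA.
    by rewrite [leqRHS]mulnCA leq_mul2l (mulnC T.+1) (mulnC (2 * u + v)%N) h orbT.
  split=> //; [ | by rewrite mulnC k1 | by rewrite [ltnRHS]mulnC].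
  rewrite -(leq_pmul2r (m := u + v)); last lia.
  by rewrite (leq_trans k1) // mulnC leq_mul // leq_addr.
set k := (_ %/ _)%N.
have k1 : (k * (2 * u + v) <= u * T.+1)%N by rewrite leq_divM.
have k2 : (u * T.+1 < k.+1 * (2 * u + v))%N by rewrite ltn_ceil //; lia.
(* Add Delta (2u+v) < (u+v) (T+1) to k (2u+v) <= u (T+1). *)
have k3 : (Delta + k <= T)%N.
  rewrite -ltnS -(ltn_pmul2r (m := 2 * u + v)); last lia.
  by rewrite mulnDl; lia.
split; [lia | | by rewrite [ltnRHS]mulnC | ].
  by rewrite (mulnC (2 * u + v)%N) k1 k3 orbT.
rewrite -(ltn_pmul2r (m := 2 * u + v)); last lia.
rewrite -(ltn_pmul2l (m := u + v)) in k2; last lia.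
rewrite -[ltnRHS]mulnA; apply: leq_ltn_trans k2; rewrite -[leqLHS]mulnA.
by rewrite [leqRHS]mulnCA leq_mul2l (ltnW h) orbT.
Qed.

Theorem proposition1 (T u v Delta : nat)
    (hT : (1 <= T)%N) (hu : (1 <= u)%N) (hDelta : (Delta <= T)%N)
    (eps : rat) (heps : 0 < eps) :
  exists N : nat, forall F : finFieldType, (N <= #|F|)%N ->
    `|coeffs_prob (fun c : coeffs F u v T Delta =>
        (column_span c)%:Z == column_span_value u v T Delta) - 1| < eps.
Proof.
(* Large enough that q - 1 is positive and exceeds (T + 5) / eps. *)
exists (Num.bound ((T + 5)%:R / eps)).+2 => F hN.
have [wT hw h1 h2] := span_index_bounds v hu hDelta.
have := card_column_span_neq F hDelta hu wT hw h1 h2.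
rewrite /coeffs_prob column_span_valueE //; set w := (span_index _ _ _ _).+1.
set bad := [set c | column_span c != w]; set good := [set c | _ == _].
have C0 : 0 < #|{: coeffs F u v T Delta}|%:R :> rat.
  by rewrite ltr0n; apply/card_gt0P; exists 0.
have -> : #|good|%:R = #|{: coeffs F u v T Delta}|%:R - #|bad|%:R :> rat.
  have -> : bad = ~: good by apply/setP => c; rewrite !inE.
  by rewrite -(cardsC good) natrD addrK.
rewrite mulrBl divff ?lt0r_neq0 // addrAC subrr add0r normrN.
rewrite ger0_norm ?divr_ge0 ?ler0n // ltr_pdivrMr // => hbad.
have q0 : (0 < #|F|.-1)%N by lia.
have : (T + 5)%:R / eps < #|F|.-1%:R.
  apply: lt_le_trans (archi_boundP _) _; first by rewrite divr_ge0 ?ler0n ?(ltW heps).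
  by rewrite ler_nat; lia.
rewrite ltr_pdivrMr // => hq.
rewrite -(ltr_pM2r (_ : 0 < #|F|.-1%:R)) ?ltr0n // -natrM.
apply: (@le_lt_trans _ _ ((T + 5) * #|{: coeffs F u v T Delta}|)%:R).
  by rewrite ler_nat.
by rewrite natrM mulrAC ltr_pM2r // mulrC.
Qed.
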